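(* The only automorphisms of the monoid $\mathcal P_{\mathrm{fin},0}(\mathbb N)$ are the identity map $X \mapsto X$ and the reversion map $X \mapsto \max X - X := \{\max X - x : x \in X\}$.
   Context: $\mathbb N$ denotes the set of non-negative integers. $\mathcal P_{\mathrm{fin},0}(\mathbb N)$ (the reduced power monoid of $(\mathbb N,+)$) is the set of all finite subsets of $\mathbb N$ containing $0$, made into a commutative monoid by the sumset operation $X + Y := \{x + y : x \in X,\ y \in Y\}$; its neutral element is $\{0\}$. An automorphism is a bijective monoid homomorphism from the monoid to itself. *)

(* Defs.v *)
From HB Require Import structures.
From mathcomp Require Import all_boot.
From mathcomp Require Import ssralg finmap.
Set Implicit Arguments.
Unset Strict Implicit.
Unset Printing Implicit Defensive.

Local Open Scope fset_scope.
Local Open Scope nat_scope.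

Definition sumset (A B : {fset nat}) : {fset nat} :=
  [fset (x + y)%N | x in A, y in B].

Definition fset_max (A : {fset nat}) : nat := \max_(x <- A) x.

Definition fset_rev (A : {fset nat}) : {fset nat} :=
  [fset (fset_max A - x)%N | x in A].

Lemma sumsetP (A B : {fset nat}) (n : nat) :
  reflect (exists x y, [/\ x \in A, y \in B & n = x + y]) (n \in sumset A B).
Proof.
apply: (iffP (imfset2P _ _ _ _ _)) => [[x xA [y yB ->]]|[x [y [xA yB ->]]]].
  by exists x, y.
by exists x => //; exists y.
Qed.

Lemma sumsetA : associative sumset.
Proof.
move=> A B C; apply/fsetP => n; apply/sumsetP/sumsetP.
  move=> [x [_ [xA /sumsetP [y [z [yB zC ->]]] ->]]].
  exists (x + y), z; split; rewrite ?addnA //.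
  by apply/sumsetP; exists x, y.
move=> [_ [z [/sumsetP [x [y [xA yB ->]]] zC ->]]].
exists x, (y + z); split; rewrite ?addnA //.
by apply/sumsetP; exists y, z.
Qed.

Lemma sumsetC : commutative sumset.
Proof.
by move=> A B; apply/fsetP => n; apply/sumsetP/sumsetP;
  move=> [x [y [xA yB ->]]]; exists y, x; rewrite addnC.
Qed.

Lemma sumset0n : left_id [fset 0] sumset.
Proof.
move=> A; apply/fsetP => n; apply/sumsetP/idP => [[x [y []]]|nA].
  by rewrite inE => /eqP -> yA ->.
by exists 0, n; rewrite inE eqxx.
Qed.

Lemma sumset_mem0 (A B : {fset nat}) : 0 \in A -> 0 \in B -> 0 \in sumset A B.
Proof. by move=> A0 B0; apply/sumsetP; exists 0, 0. Qed.

Lemma leq_fset_max (A : {fset nat}) (x : nat) : x \in A -> x <= fset_max A.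
Proof. by move=> xA; rewrite /fset_max; exact: (@leq_bigmax_seq _ _ predT id). Qed.

Lemma mem_fset_max (A : {fset nat}) : A != fset0 -> fset_max A \in A.
Proof.
case/fset0Pn => x0 x0A; rewrite /fset_max.
have bigmax_mem (s : seq nat) : s != [::] -> \max_(x <- s) x \in s.
  elim: s => // a s IHs _; rewrite big_cons inE.
  have [->|/IHs ms] := eqVneq s [::]; first by rewrite big_nil maxn0 eqxx.
  by rewrite /maxn; case: ifP => _; rewrite ?ms ?eqxx ?orbT.
by apply: bigmax_mem; apply: contraTneq x0A => A0; rewrite -[x0 \in A]/(x0 \in enum_fset A) A0.
Qed.

Lemma fset_rev_mem0 (A : {fset nat}) : 0 \in A -> 0 \in fset_rev A.
Proof.
move=> A0; apply/imfsetP; exists (fset_max A); rewrite ?subnn //=.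
by apply: mem_fset_max; apply/fset0Pn; exists 0.
Qed.

Record pfin0 : Type := PFin0 { pfin0_val :> {fset nat}; _ : 0 \in pfin0_val }.

HB.instance Definition _ := [isSub for pfin0_val].
HB.instance Definition _ := [Choice of pfin0 by <:].

Definition pfin0_zero : pfin0 := PFin0 (fset11 0).

Definition pfin0_add (X Y : pfin0) : pfin0 :=
  PFin0 (sumset_mem0 (valP X) (valP Y)).

Lemma pfin0_addA : associative pfin0_add.
Proof. by move=> X Y Z; apply: val_inj; exact: sumsetA. Qed.

Lemma pfin0_addC : commutative pfin0_add.
Proof. by move=> X Y; apply: val_inj; exact: sumsetC. Qed.

Lemma pfin0_add0 : left_id pfin0_zero pfin0_add.
Proof. by move=> X; apply: val_inj; exact: sumset0n. Qed.

HB.instance Definition _ :=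
  GRing.isNmodule.Build pfin0 pfin0_addA pfin0_addC pfin0_add0.

Definition reversion (X : pfin0) : pfin0 := PFin0 (fset_rev_mem0 (valP X)).

Definition automorphism (V : nmodType) (f : V -> V) : Prop :=
  GRing.nmod_morphism f /\ bijective f.

(* Main.v *)
(** Write [I n = [0,n]], [D n = {0,n}], [E b c = {0} ∪ [b,c]] and [R b c] for
    the reversion [[0,c-b] ∪ {c}] of [E b c]. For large [c],
    adding [E b c] to [X] keeps exactly [X ∩ [0,b-1]] and fills up everything
    above, so that [b \in X] iff
    [X + E (b+1) (c+b) = X + D b + E (b+1) c].  An automorphism that fixes all
    [D b] and all [E b c] with [c] large is therefore the identity.
    Since [X + I k = I (max X + k)] for large [k], automorphisms preserve maxima
    and fix intervals, hence preserve the largest gap, hence fix [D n].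
    The equations [E b c + D d + D e = E b c + D (d+e)], for [d, e >= b], force
    the image of [E b c] to contain [[b,c-b]]; its largest gap and the equation
    [E b c + R b c = I (2c)] then leave only [E b c] and its
    reversion, and the same alternative occurs for all [b] and [c] because
    [E b c + R b' c'] is an interval while [E b c + E b' c'] is not. *)
Require Import Defs.
From mathcomp Require Import all_boot.
From mathcomp Require Import ssralg finmap zify.
Set Implicit Arguments.
Unset Strict Implicit.
Unset Printing Implicit Defensive.

Local Open Scope nat_scope.

(** * Membership, maxima and the reversion automorphism *)

Lemma pfin0_eqP (X Y : pfin0) :
  (forall n, n \in pfin0_val X <-> n \in pfin0_val Y) -> X = Y.
Proof.
by move=> XY; apply: val_inj; apply/fsetP => n; apply/idP/idP => /XY.
Qed.

Lemma mem0_pfin0 (X : pfin0) : 0 \in pfin0_val X.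
Proof. exact: (valP X). Qed.

Lemma mem_addP (X Y : pfin0) n :
  reflect (exists x y, [/\ x \in pfin0_val X, y \in pfin0_val Y & n = x + y])
    (n \in pfin0_val (X + Y)%R).
Proof. exact: sumsetP. Qed.

Lemma mem_add (X Y : pfin0) x y n :
  x \in pfin0_val X -> y \in pfin0_val Y -> n = x + y ->
  n \in pfin0_val (X + Y)%R.
Proof. by move=> xX yY ->; apply/mem_addP; exists x, y. Qed.

Lemma mem0_zero n : (n \in pfin0_val 0%R) = (n == 0).
Proof. exact: in_fset1. Qed.

Lemma leq_max_pfin0 (X : pfin0) x : x \in pfin0_val X -> x <= fset_max X.
Proof. exact: leq_fset_max. Qed.

Lemma mem_max_pfin0 (X : pfin0) : fset_max X \in pfin0_val X.
Proof. by apply: mem_fset_max; apply/fset0Pn; exists 0; exact: mem0_pfin0. Qed.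

Lemma max_pfin0_eq (X : pfin0) m :
  m \in pfin0_val X -> (forall x, x \in pfin0_val X -> x <= m) -> fset_max X = m.
Proof.
move=> mX ubm; apply/eqP; rewrite eqn_leq (leq_max_pfin0 mX) andbT.
exact/ubm/mem_max_pfin0.
Qed.

Lemma max_add (X Y : pfin0) : fset_max (X + Y)%R = fset_max X + fset_max Y.
Proof.
apply: max_pfin0_eq => [|_ /mem_addP[x [y [xX yY ->]]]].
  by apply: mem_add erefl; exact: mem_max_pfin0.
by apply: leq_add; exact: leq_max_pfin0.
Qed.

Lemma mem_reversion (X : pfin0) n :
  (n \in pfin0_val (reversion X)) =
  (n <= fset_max X) && (fset_max X - n \in pfin0_val X).
Proof.
apply/imfsetP/andP => /= [[x xX ->]|[nm mnX]].
  by have xm := leq_max_pfin0 xX; rewrite leq_subr subKn.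
by exists (fset_max X - n); rewrite ?subKn.
Qed.

Lemma max_reversion (X : pfin0) : fset_max (reversion X) = fset_max X.
Proof.
apply: max_pfin0_eq => [|x]; rewrite mem_reversion.
  by rewrite leqnn subnn mem0_pfin0.
by case/andP.
Qed.

Lemma reversionK : involutive reversion.
Proof.
move=> X; apply: pfin0_eqP => n; rewrite !mem_reversion max_reversion.
split=> [/and3P[nm _]|nX]; first by rewrite subKn.
by have nm := leq_max_pfin0 nX; rewrite nm leq_subr subKn.
Qed.

Lemma reversion_add : {morph reversion : X Y / (X + Y)%R}.
Proof.
move=> X Y; apply: pfin0_eqP => n; rewrite mem_reversion max_add; split.
  case/andP=> nm /mem_addP[x [y [xX yY def_n]]].
  have := leq_max_pfin0 xX; have := leq_max_pfin0 yY => ym xm.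
  apply: (@mem_add _ _ (fset_max X - x) (fset_max Y - y)); last by lia.
    by rewrite mem_reversion leq_subr subKn.
  by rewrite mem_reversion leq_subr subKn.
case/mem_addP=> x [y []]; rewrite !mem_reversion => /andP[xm xX] /andP[ym yY] ->.
by rewrite leq_add //; apply: mem_add xX yY _; lia.
Qed.

Lemma automorphism_reversion : automorphism reversion.
Proof.
split; last by exists reversion; exact: reversionK.
split; last exact: reversion_add.
have max0 : fset_max (0%R : pfin0) = 0.
  by apply: max_pfin0_eq => [|x]; rewrite mem0_zero // => /eqP ->.
apply: pfin0_eqP => n; rewrite mem_reversion max0 !mem0_zero; lia.
Qed.

Lemma automorphism_comp (V : nmodType) (f g : V -> V) :
  automorphism f -> automorphism g -> automorphism (f \o g).
Proof.
move=> [[f0 fD] fbij] [[g0 gD] gbij]; split; last exact: bij_comp.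
by split=> [|x y] /=; rewrite ?g0 ?gD.
Qed.

(** * The test sets [I], [D], [E], [R] and their sumset identities *)

Definition pset (c : nat) (P : pred nat) : {fset nat} :=
  [fset x in 0 :: [seq x <- iota 0 c.+1 | P x]]%fset.

Lemma mem_pset c P x : (x \in pset c P) = (x == 0) || (x <= c) && P x.
Proof. by rewrite !inE mem_filter mem_iota ltnS andbC. Qed.

Lemma mem0_pset c P : 0 \in pset c P.
Proof. by rewrite mem_pset. Qed.

Definition I n : pfin0 := PFin0 (mem0_pset n predT).
Definition D n : pfin0 := PFin0 (mem0_pset n (pred1 n)).
Definition E b c : pfin0 := PFin0 (mem0_pset c (leq b)).
Definition R b c : pfin0 := PFin0 (mem0_pset c [pred x | (x + b <= c) || (x == c)]).

Lemma mem_I n x : (x \in pfin0_val (I n)) = (x <= n).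
Proof. by rewrite mem_pset andbT; case: x. Qed.

Lemma mem_D n x : (x \in pfin0_val (D n)) = (x == 0) || (x == n).
Proof. by rewrite mem_pset /=; lia. Qed.

Lemma mem_E b c x : (x \in pfin0_val (E b c)) = (x == 0) || (b <= x <= c).
Proof. by rewrite mem_pset [(b <= x) && _]andbC. Qed.

Lemma mem_R b c x :
  (x \in pfin0_val (R b c)) = (x == 0) || (x + b <= c) || (x == c).
Proof. by rewrite mem_pset /=; lia. Qed.

Lemma max_I n : fset_max (I n) = n.
Proof. by apply: max_pfin0_eq => [|x]; rewrite mem_I. Qed.

Lemma max_D n : fset_max (D n) = n.
Proof. by apply: max_pfin0_eq => [|x]; rewrite mem_D; lia. Qed.

Lemma max_E b c : b <= c -> fset_max (E b c) = c.
Proof. by move=> bc; apply: max_pfin0_eq => [|x]; rewrite mem_E; lia. Qed.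

Lemma reversion_I n : reversion (I n) = I n.
Proof.
by apply: pfin0_eqP => x; rewrite mem_reversion max_I !mem_I; lia.
Qed.

Lemma reversion_D n : reversion (D n) = D n.
Proof.
by apply: pfin0_eqP => x; rewrite mem_reversion max_D !mem_D; lia.
Qed.

Lemma reversion_E b c : b <= c -> reversion (E b c) = R b c.
Proof.
move=> bc; apply: pfin0_eqP => x.
by rewrite mem_reversion max_E // mem_E mem_R; lia.
Qed.

(** The translates of [[0,k]] by [0] and by [fset_max X] already cover everything, since
    [fset_max X <= k] leaves no hole between them. *)
Lemma add_I (X : pfin0) k :
  fset_max X <= k -> (X + I k)%R = I (fset_max X + k).
Proof.
move=> mk; apply: pfin0_eqP => n; rewrite mem_I; split.
  case/mem_addP=> x [y [/leq_max_pfin0 xm]]; rewrite mem_I; lia.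
move=> nm; case: (leqP n k) => nk.
  by apply: (mem_add (mem0_pfin0 X) (y := n)); rewrite ?mem_I.
by apply: (mem_add (mem_max_pfin0 X) (y := n - fset_max X)); rewrite ?mem_I; lia.
Qed.

Lemma I_mulrn n : I n = (I 1 *+ n)%R.
Proof.
elim: n => [|n IHn]; first by apply: pfin0_eqP => x; rewrite mem_I mem0_zero leqn0.
rewrite GRing.mulrS -IHn; case: n {IHn} => [|n].
  apply: pfin0_eqP => x; rewrite mem_I; split=> [x1|].
    by apply: (mem_add (x := x) (y := 0)); rewrite ?mem_I //; lia.
  by case/mem_addP=> y [z []]; rewrite !mem_I; lia.
by rewrite add_I max_I.
Qed.

Lemma max_mulrn (X : pfin0) n : fset_max (X *+ n)%R = fset_max X * n.
Proof.
elim: n => [|n IHn].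
  by rewrite muln0; apply: max_pfin0_eq => [|x]; rewrite mem0_zero // => /eqP ->.
by rewrite GRing.mulrS max_add IHn mulnS.
Qed.

(** A sum at most [c] is [0] or at least [b], hence lies in [E b c] itself. A sum [n > c] satisfies
    [n - (d + e) >= b] by the third hypothesis, so it lies in the translate by [d + e]. *)
Lemma E_absorbs b c d e : b <= d -> b <= e -> d + e + b <= c.+1 ->
  (E b c + D d + D e = E b c + D (d + e))%R.
Proof.
move=> bd be dec; apply: pfin0_eqP => n; split.
  case/mem_addP=> _ [z [/mem_addP[x [y [xE yD ->]]] zD ->]].
  move: xE yD zD; rewrite mem_E !mem_D => xE yD zD.
  have [le_c|gt_c] := leqP (x + y + z) c.
    by apply: (@mem_add _ _ (x + y + z) 0); rewrite ?mem_E ?mem_D; lia.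
  by apply: (@mem_add _ _ (x + y + z - (d + e)) (d + e));
    rewrite ?mem_E ?mem_D; lia.
case/mem_addP=> x [y [xE]]; rewrite mem_D => yD ->.
case/orP: yD => /eqP ->.
  apply: (@mem_add _ _ x 0); rewrite ?addn0 ?mem_D //.
  by apply: (@mem_add _ _ x 0); rewrite ?addn0 ?mem_D.
apply: (@mem_add _ _ (x + d) e); rewrite ?addnA ?mem_D ?eqxx ?orbT //.
by apply: (@mem_add _ _ x d); rewrite ?mem_D ?eqxx ?orbT.
Qed.

Lemma R_absorbs b c d e : b <= d -> b <= e -> d + e + b <= c.+1 ->
  (R b c + D d + D e = R b c + D (d + e))%R.
Proof.
move=> bd be dec; have bc : b <= c by lia.
by rewrite -reversion_E // -(reversion_D d) -(reversion_D e)
  -(reversion_D (d + e)) -!reversion_add E_absorbs.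
Qed.

(** The hole between [0] and [b] is one longer than [I (b - 2)] can fill: [b - 1] stays
    uncovered. *)
Lemma E_gap b c : 1 < b <= c -> (E b c + I (b - 2))%R <> I (c + (b - 2)).
Proof.
move=> bc EI; have : b - 1 \in pfin0_val (I (c + (b - 2))) by rewrite mem_I; lia.
by rewrite -EI => /mem_addP[x [y []]]; rewrite mem_E mem_I; lia.
Qed.

Lemma R_gap b c : 1 < b <= c -> (R b c + I (b - 2))%R <> I (c + (b - 2)).
Proof.
move=> bc RI; apply: (E_gap bc); apply: (can_inj reversionK).
by rewrite reversion_add reversion_E ?reversion_I //; lia.
Qed.

(** The gap of each summand is bridged by the long block of the other: the low end comes from
    [0 + R b' c'], the high end from [E b c + c']. *)
Lemma add_E_R b c b' c' : 0 < b -> b + b' <= c -> b + b' <= c' ->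
  (E b c + R b' c')%R = I (c + c').
Proof.
move=> b0 bc bc'; apply: pfin0_eqP => n; rewrite mem_I; split.
  by case/mem_addP=> x [y []]; rewrite mem_E mem_R; lia.
move=> nc; case: (leqP (n + b') c') => n1.
  by apply: (@mem_add _ _ 0 n); rewrite ?mem_E ?mem_R; lia.
case: (leqP n (c + c' - b')) => n2; last first.
  by apply: (@mem_add _ _ (n - c') c'); rewrite ?mem_E ?mem_R; lia.
case: (leqP n c) => n3.
  by apply: (@mem_add _ _ n 0); rewrite ?mem_E ?mem_R; lia.
by apply: (@mem_add _ _ c (n - c)); rewrite ?mem_E ?mem_R; lia.
Qed.

Lemma add_E_E_neq_I b c b' c' : 1 < b -> 1 < b' -> 0 < c ->
  (E b c + E b' c')%R <> I (c + c').
Proof.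
move=> b1 b'1 c0 EI; have : 1 \in pfin0_val (I (c + c')) by rewrite mem_I; lia.
by rewrite -EI => /mem_addP[x [y []]]; rewrite !mem_E; lia.
Qed.

(** Both sides agree with [X] below [b] and contain everything from [b + 1] to the common maximum.
    They can differ only at [b], which the right side always contains and the left side contains
    only if [X] does. *)
Lemma mem_iff_add_E (X : pfin0) b c : 0 < b -> fset_max X + 2 * b < c ->
  b \in pfin0_val X <->
  (X + E b.+1 (c + b) = X + D b + E b.+1 c)%R.
Proof.
move=> b0 mc; pose m := fset_max X.
have mX : m \in pfin0_val X := mem_max_pfin0 X.
split=> [bX|XE]; last first.
  have : b \in pfin0_val (X + D b + E b.+1 c)%R.
    apply: (@mem_add _ _ b 0); rewrite ?addn0 ?mem0_pfin0 //.
    by apply: (@mem_add _ _ 0 b); rewrite ?mem0_pfin0 ?mem_D ?eqxx ?orbT.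
  rewrite -XE => /mem_addP[x [y [xX]]]; rewrite mem_E => yE def_b.
  by have -> : b = x by lia.
apply: pfin0_eqP => n; split.
  case/mem_addP=> x [y [xX]]; rewrite mem_E => yE ->.
  have := leq_max_pfin0 xX => xm.
  have [y0|y0] := eqVneq y 0.
    apply: (@mem_add _ _ x 0); rewrite ?y0 ?mem0_pfin0 //.
    by apply: (@mem_add _ _ x 0); rewrite ?addn0 ?mem0_pfin0.
  (* The right side is filled by the translates of [[b+1,c]] by [0], [b] and [m + b], which overlap
     because [c] is large. *)
  have [n1|n1] := leqP (x + y) c.
    apply: (@mem_add _ _ 0 (x + y)); rewrite ?mem0_pfin0 ?mem_E //; lia.
  have [n2|n2] := leqP (x + y) (c + b).
    apply: (@mem_add _ _ b (x + y - b)); rewrite ?mem_E; [|lia..].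
    by apply: (@mem_add _ _ 0 b); rewrite ?mem0_pfin0 ?mem_D ?eqxx ?orbT.
  apply: (@mem_add _ _ (m + b) (x + y - (m + b))); rewrite ?mem_E; [|lia..].
  by apply: (@mem_add _ _ m b); rewrite ?mem_D ?eqxx ?orbT.
case/mem_addP=> _ [z [/mem_addP[x [y [xX yD ->]]] zE ->]].
move: yD zE; rewrite mem_D mem_E => yD zE; have := leq_max_pfin0 xX => xm.
have [n0|n0] := boolP ((y == 0) && (z == 0)).
  by apply: (@mem_add _ _ x 0); rewrite ?mem0_pfin0 //; lia.
have [n1|n1] := leqP (x + y + z) b.
  by apply: (@mem_add _ _ b 0); rewrite ?mem0_pfin0 //; lia.
have [n2|n2] := leqP (x + y + z) (c + b).
  by apply: (@mem_add _ _ 0 (x + y + z)); rewrite ?mem0_pfin0 ?mem_E //; lia.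
by apply: (@mem_add _ _ m (x + y + z - m)); rewrite ?mem_E //; lia.
Qed.

(** * Sets [A] that satisfy the absorption equations, as the images of [E b c] and [R b c] will *)

Section Alternative.

Variables (A : pfin0) (b c : nat).
Hypotheses (b_gt1 : 1 < b) (bc : 4 * b <= c) (max_A : fset_max A = c).
Hypothesis absA : forall d e, b <= d -> b <= e -> d + e + b <= c.+1 ->
  (A + D d + D e = A + D (d + e))%R.

(** For small [x], take [d = x] and [e = b]: the sum [x] is too small to use [x + b] on the right.
    For large [x], take [d = c - x] and [e = b]: the sum [c + b] exceeds [c], so it must use
    [d + b], which leaves [x]. *)
Lemma absorbing_middle x : b <= x -> x + b <= c -> x \in pfin0_val A.
Proof.
move=> bx xc; have [x_low|x_high] := leqP (x + 2 * b) c.+1.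
  have : x \in pfin0_val (A + D x + D b)%R.
    apply: (@mem_add _ _ x 0); rewrite ?mem_D ?addn0 //.
    by apply: (@mem_add _ _ 0 x); rewrite ?mem_D ?mem0_pfin0 ?eqxx ?orbT.
  rewrite absA //; last by lia.
  case/mem_addP=> y [z [yA]]; rewrite mem_D => zD def_x.
  by have -> : x = y by lia.
pose d := c - x.
have : c + b \in pfin0_val (A + D d + D b)%R.
  apply: (@mem_add _ _ c b); rewrite ?mem_D ?eqxx ?orbT //.
  apply: (@mem_add _ _ c 0); rewrite ?mem_D ?addn0 //.
  by rewrite -max_A mem_max_pfin0.
rewrite absA //; [|by rewrite /d; lia..].
case/mem_addP=> y [z [yA]]; rewrite mem_D => zD def_c.
have := leq_max_pfin0 yA; rewrite max_A => yc.
by have -> : x = y by rewrite /d in zD def_c; lia.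
Qed.

(** With elements strictly inside both end zones, and the middle full, consecutive elements of [A]
    would differ by at most [b - 1], so [I (b - 2)] would fill every hole. *)
Lemma absorbing_gap : (A + I (b - 2))%R <> I (c + (b - 2)) ->
  (forall x, 0 < x < b -> x \notin pfin0_val A) \/
  (forall x, 0 < x < b -> c - x \notin pfin0_val A).
Proof.
move=> gapA.
have [/hasP[x]|/hasPn noL] := boolP (has [in pfin0_val A] (iota 1 b.-1)); last first.
  by left=> x xb; apply: noL; rewrite mem_iota; lia.
rewrite mem_iota => xb xA.
have [/hasP[y]|/hasPn noR] :=
    boolP (has (fun y => c - y \in pfin0_val A) (iota 1 b.-1)); last first.
  by right=> y yb; apply: noR; rewrite mem_iota; lia.
rewrite mem_iota => yb yA; case: gapA.
apply: pfin0_eqP => n; rewrite mem_I; split.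
  by case/mem_addP=> u [v [/leq_max_pfin0]]; rewrite max_A mem_I; lia.
move=> nc.
have cover u : u \in pfin0_val A -> u <= n <= u + (b - 2) ->
    n \in pfin0_val (A + I (b - 2))%R.
  by move=> uA un; apply: (@mem_add _ _ u (n - u)) => //; rewrite ?mem_I; lia.
(* The extra elements [x] and [c - y] serve only to reach [n = b - 1] and [n = c - 1]. *)
have [n1|n1] := leqP n (b - 2); first by apply: (cover 0); rewrite ?mem0_pfin0.
have [n2|n2] := ltnP n b; first by apply: (cover x) => //; lia.
have [n3|n3] := leqP (n + b) c.
  by apply: (cover n); rewrite ?absorbing_middle //; lia.
have [n4|n4] := leqP n (c - 2).
  by apply: (cover (c - b)); rewrite ?absorbing_middle //; lia.
have [n5|n5] := ltnP n c; first by apply: (cover (c - y)) => //; lia.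
by apply: (cover c); rewrite -?max_A ?mem_max_pfin0 ?max_A //; lia.
Qed.

End Alternative.

(** * Action of an automorphism on maxima and test sets *)

Section Automorphism.

Variable f : pfin0 -> pfin0.
Hypothesis autf : automorphism f.

Lemma aut_add X Y : f (X + Y)%R = (f X + f Y)%R.
Proof. by case: autf => -[_ ->]. Qed.

Lemma aut_inj : injective f.
Proof. by case: autf => _ /bij_inj. Qed.

Lemma aut_mulrn X n : f (X *+ n)%R = (f X *+ n)%R.
Proof.
elim: n => [|n IHn]; first by rewrite !GRing.mulr0n; case: autf => -[].
by rewrite !GRing.mulrS aut_add IHn.
Qed.

(** Apply [f] to [X + I m = I (m + m)] with [m = fset_max X], and compare maxima, using that [I n]
    is the [n]-fold sum of [I 1]. *)
Lemma max_aut_mul X : fset_max (f X) = fset_max X * fset_max (f (I 1)).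
Proof.
have := congr1 (fun Y => fset_max (f Y)) (add_I (leqnn (fset_max X))).
rewrite aut_add max_add !(I_mulrn (fset_max X)) (I_mulrn (_ + _)).
by rewrite !aut_mulrn !max_mulrn; lia.
Qed.

Lemma max_aut X : fset_max (f X) = fset_max X.
Proof.
have [g _ gK] := autf.2.
(* By surjectivity the scaling factor divides [1]. *)
have := max_aut_mul (g (I 1)); rewrite gK max_I => /esym/eqP.
by rewrite muln_eq1 => /andP[_ /eqP f1]; rewrite max_aut_mul f1 muln1.
Qed.

Lemma aut_I n : f (I n) = I n.
Proof.
suff f1 : f (I 1) = I 1 by rewrite I_mulrn aut_mulrn f1.
have max1 : fset_max (f (I 1)) = 1 by rewrite max_aut max_I.
apply: pfin0_eqP => x; rewrite mem_I; split=> [/leq_max_pfin0|].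
  by rewrite max1.
case: x => [|[|]] // _; first exact: mem0_pfin0.
by rewrite -[X in X \in _]max1 mem_max_pfin0.
Qed.

(** An element of [f (D n)] strictly between [0] and [n] would shorten the gap, so that [I (n - 2)]
    fills it; pulled back by [f], this fails for [D n] at [n - 1]. *)
Lemma aut_D n : f (D n) = D n.
Proof.
have maxD : fset_max (f (D n)) = n by rewrite max_aut max_D.
have nD : n \in pfin0_val (f (D n)) by rewrite -[X in X \in _]maxD mem_max_pfin0.
apply: pfin0_eqP => x; rewrite mem_D; split; last first.
  by case/orP=> /eqP ->; rewrite ?mem0_pfin0.
move=> xD; apply: contraT => x_inner.
have := leq_max_pfin0 xD; rewrite maxD => xn.
have DI : (D n + I (n - 2))%R = I (n + (n - 2)).
  apply: aut_inj; rewrite aut_add !aut_I; apply: pfin0_eqP => k.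
  rewrite mem_I; split.
    by case/mem_addP=> u [v [/leq_max_pfin0]]; rewrite maxD mem_I; lia.
  move=> kn.
  have cover u : u \in pfin0_val (f (D n)) -> u <= k <= u + (n - 2) ->
      k \in pfin0_val (f (D n) + I (n - 2))%R.
    by move=> uA uk; apply: (@mem_add _ _ u (k - u)) => //; rewrite ?mem_I; lia.
  have [k1|k1] := leqP k (n - 2); first by apply: (cover 0); rewrite ?mem0_pfin0.
  have [k2|k2] := ltnP k n; first by apply: (cover x) => //; lia.
  by apply: (cover n) => //; lia.
have : n - 1 \in pfin0_val (I (n + (n - 2))) by rewrite mem_I; lia.
by rewrite -DI => /mem_addP[u [v []]]; rewrite mem_D mem_I; lia.
Qed.

(** The images [A] and [A'] of [E b c] and [R b c] each have a gap at one end. The gaps lie at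
    opposite ends, since [1] and [2c - 1] belong to [A + A']; the sums near the end where [A'] has
    its gap then force [A] to be full there. *)
Lemma aut_E b c : 1 < b -> 4 * b <= c -> f (E b c) = E b c \/ f (E b c) = R b c.
Proof.
move=> b_gt1 bc; have b_le_c : b <= c by lia.
set A := f (E b c); set A' := f (R b c).
have max_A : fset_max A = c by rewrite max_aut max_E.
have max_A' : fset_max A' = c.
  by rewrite max_aut -reversion_E // max_reversion max_E.
have absA d e : b <= d -> b <= e -> d + e + b <= c.+1 ->
    (A + D d + D e = A + D (d + e))%R.
  by move=> bd be dec; rewrite -(aut_D d) -(aut_D e) -(aut_D (d + e)) -!aut_add E_absorbs.
have absA' d e : b <= d -> b <= e -> d + e + b <= c.+1 ->
    (A' + D d + D e = A' + D (d + e))%R.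
  by move=> bd be dec; rewrite -(aut_D d) -(aut_D e) -(aut_D (d + e)) -!aut_add R_absorbs.
have gapA : (A + I (b - 2))%R <> I (c + (b - 2)).
  rewrite -(aut_I (b - 2)) -aut_add -(aut_I (c + _)) => /aut_inj.
  by apply: E_gap; lia.
have gapA' : (A' + I (b - 2))%R <> I (c + (b - 2)).
  rewrite -(aut_I (b - 2)) -aut_add -(aut_I (c + _)) => /aut_inj.
  by apply: R_gap; lia.
have AA' : (A + A')%R = I (c + c) by rewrite -aut_add add_E_R ?aut_I //; lia.
have midA := absorbing_middle b_gt1 bc max_A absA.
have A_le x : x \in pfin0_val A -> x <= c by move/leq_max_pfin0; rewrite max_A.
have A'_le x : x \in pfin0_val A' -> x <= c by move/leq_max_pfin0; rewrite max_A'.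
have cA : c \in pfin0_val A by rewrite -max_A mem_max_pfin0.
have sumP n : n <= c + c -> exists x y,
    [/\ x \in pfin0_val A, y \in pfin0_val A' & n = x + y].
  by move=> nc; apply/mem_addP; rewrite AA' mem_I.
have [lowA|highA] := absorbing_gap b_gt1 bc max_A absA gapA.
- left.
  have [lowA'|highA'] := absorbing_gap b_gt1 bc max_A' absA' gapA'.
    have [|x [y [xA yA' xy]]] := sumP 1; first by lia.
    have [y1|y0] : y = 1 \/ x = 1 by lia.
      by move: yA'; rewrite y1 (negPf (lowA' _ _)).
    by move: xA; rewrite y0 (negPf (lowA _ _)).
  have topA t : t < b -> c - t \in pfin0_val A.
    move=> tb; have [|x [y [xA yA' xy]]] := sumP (c + c - t); first by lia.
    have := A_le _ xA; have := A'_le _ yA' => yc xc.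
    have [yc'|yc'] := eqVneq y c; first by have -> : c - t = x by lia.
    have : c - (c - y) \notin pfin0_val A' by apply: highA'; lia.
    by rewrite subKn // yA'.
  apply: pfin0_eqP => x; rewrite mem_E; split=> [xA|].
    have := A_le _ xA; case: (boolP (0 < x < b)) => [/lowA|]; last by lia.
    by rewrite xA.
  case/orP=> [/eqP ->|bxc]; first exact: mem0_pfin0.
  have [x1|x1] := leqP (x + b) c; first by apply: midA => //; lia.
  by rewrite -(subKn (n := c) (m := x)) ?topA //; lia.
- right.
  have [lowA'|highA'] := absorbing_gap b_gt1 bc max_A' absA' gapA'; last first.
    have [|x [y [xA yA' xy]]] := sumP (c + c - 1); first by lia.
    have := A_le _ xA; have := A'_le _ yA' => yc xc.
    have [y1|y0] : y = c - 1 \/ x = c - 1 by lia.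
      by move: yA'; rewrite y1 (negPf (highA' _ _)).
    by move: xA; rewrite y0 (negPf (highA _ _)).
  have botA t : t < b -> t \in pfin0_val A.
    move=> tb; have [|x [y [xA yA' xy]]] := sumP t; first by lia.
    have [y0|y0] := eqVneq y 0; first by have -> : t = x by lia.
    by move: yA'; rewrite (negPf (lowA' _ _)) //; lia.
  apply: pfin0_eqP => x; rewrite mem_R; split=> [xA|].
    have xc := A_le _ xA; case: (boolP (0 < c - x < b)) => [/highA|]; last by lia.
    by rewrite subKn // xA.
  case/orP=> [|/eqP -> //] xb.
  by have [x1|x1] := ltnP x b; [apply: botA|apply: midA => //; lia].
Qed.

(** Otherwise [f] would send [E b c + E b' c'], which misses [1], to an interval, and intervals are
    fixed. *)
Lemma aut_E_consistent b c b' c' : 1 < b -> 1 < b' -> b + b' <= c -> b + b' <= c' ->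
  f (E b c) = E b c -> f (E b' c') <> R b' c'.
Proof.
move=> b1 b'1 bc bc' fE fR.
apply: (@add_E_E_neq_I b c b' c') => //; first by lia.
by apply: aut_inj; rewrite aut_add fE fR aut_I add_E_R //; lia.
Qed.

Lemma aut_id_of_E : f (E 2 8) = E 2 8 -> f =1 id.
Proof.
move=> f28.
(* [(2, 8)] is the least pair allowed by [aut_E]. It is linked to [(b, c)] through [(2, c)], because
   the comparison needs both upper ends to be at least [2 + b]. *)
have f2 c : 8 <= c -> f (E 2 c) = E 2 c.
  move=> c8; case: (@aut_E 2 c) => // fR.
  by case: (aut_E_consistent _ _ _ _ f28 fR) => //; lia.
have fE b c : 1 < b -> 4 * b <= c -> f (E b c) = E b c.
  move=> b1 bc; case: (aut_E b1 bc) => // fR.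
  have c8 : 8 <= c by lia.
  by case: (aut_E_consistent _ _ _ _ (f2 _ c8) fR) => //; lia.
move=> X; apply: pfin0_eqP => -[|b]; first by rewrite !mem0_pfin0.
(* Large enough both for the membership test at [b.+1] and for [f] to fix the two sets [E] in it; as
   [f] preserves maxima, the same [c] serves [f X]. *)
pose c := fset_max X + 4 * b.+2.
have memE (Y : pfin0) : fset_max Y = fset_max X ->
    b.+1 \in pfin0_val Y <-> (Y + E b.+2 (c + b.+1) = Y + D b.+1 + E b.+2 c)%R.
  by move=> mY; apply: mem_iff_add_E; rewrite // mY /c; lia.
have fXE : f (X + E b.+2 (c + b.+1))%R = (f X + E b.+2 (c + b.+1))%R.
  by rewrite aut_add fE // /c; lia.
have fXDE : f (X + D b.+1 + E b.+2 c)%R = (f X + D b.+1 + E b.+2 c)%R.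
  by rewrite !aut_add aut_D fE // /c; lia.
split=> [/(memE _ (max_aut X))|/(memE _ erefl) XE].
  by rewrite -fXE -fXDE => /aut_inj /(memE _ erefl).
by apply/(memE _ (max_aut X)); rewrite -fXE -fXDE XE.
Qed.

End Automorphism.

Theorem theorem3p2 (f : pfin0 -> pfin0) :
  automorphism f <-> f =1 id \/ f =1 reversion.
Proof.
have eq_aut (g h : pfin0 -> pfin0) : g =1 h -> automorphism g -> automorphism h.
  move=> gh [[g0 gD] gbij]; split; last exact: eq_bij gbij _ gh.
  by split=> [|X Y]; rewrite -!gh.
split=> [autf|[fE|fE]]; last first.
- exact: eq_aut (fsym fE) automorphism_reversion.
- by apply: (eq_aut (@id pfin0) f (fsym fE)); split; last exists id.
have [] // := aut_E autf (isT : 1 < 2) (leqnn 8) => [f28|f28].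
  by left; apply: aut_id_of_E.
(* Here [reversion \o f] fixes [E 2 8], hence is the identity. *)
right=> X; apply: (inv_inj reversionK); rewrite reversionK.
apply: (aut_id_of_E (automorphism_comp automorphism_reversion autf)) => /=.
by rewrite f28 -reversion_E // reversionK.
Qed.
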